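(* Let $E$ be a finite set with $N$ points and let $\succcurlyeq_1,\dots,\succcurlyeq_M$ be linear orders on $E$. For each $i$ and $x\in E$ let $j_i(x)\in\{1,\dots,N\}$ be the position of $x$ in the $i$-th order (writing $E$ as $x_{i1}\succ_i\dots\succ_i x_{iN}$, $x=x_{ij_i(x)}$), and define $F:E\to\mathbb{R}^M$ by $F(x)=(F_1(x),\dots,F_M(x))$ with $F_i(x)=-(M+1)^{j_i(x)}$. For $P\subseteq F(E)$ let $\mathrm{ExtHull}(P)=\{x\in\mathbb{R}^M:\ \exists p\in\mathrm{Hull}(P)\text{ with } x_i\ge p_i\ \forall i\}$. For $\lambda>0$ let $Q_\lambda=\{0\}\cup\{\lambda e_i:1\le i\le M\}$, where $e_i$ is the $i$-th standard basis vector of $\mathbb{R}^M$. Then there exists $\lambda>0$ such that for every $P\subseteq F(E)$, $\mathrm{Hull}(P\cup Q_\lambda)\cap F(E)=\mathrm{ExtHull}(P)\cap F(E)$.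
   Context: $\mathrm{Hull}$ denotes the convex hull in $\mathbb{R}^M$. A linear order is total and antisymmetric; $x\succ_i y$ means $x\succcurlyeq_i y$ and $x\neq y$. *)

(* Defs.v *)
(* MathComp-Analysis *)
From mathcomp Require Import all_boot all_order all_algebra.
From mathcomp Require Import all_classical all_reals convex.

Set Implicit Arguments.
Unset Strict Implicit.
Unset Printing Implicit Defensive.

Import Order.TTheory GRing.Theory Num.Theory.

Local Open Scope classical_set_scope.
Local Open Scope ring_scope.

Definition linear_order (E : Type) (ge : rel E) : Prop :=
  [/\ reflexive ge, antisymmetric ge, transitive ge & total ge].

(* [ge x y] reads "x is above y", so [sort ge (enum E)] lists E from top to
   bottom; positions in that list are counted from 1. *)
Definition position (E : finType) (ge : rel E) (x : E) : nat :=
  (index x (sort ge (enum E))).+1.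

Definition embed (R : realType) (E : finType) (M : nat)
    (ge : 'I_M -> rel E) (x : E) : 'rV[R]_M :=
  \row_i - (M.+1%:R ^+ position (ge i) x).

Definition hull (R : realType) (M : nat) (P : set 'rV[R]_M) : set 'rV[R]_M :=
  smallest (@convex_set R 'rV[R]_M) P.

Definition ext_hull (R : realType) (M : nat) (P : set 'rV[R]_M) :
    set 'rV[R]_M :=
  [set x : 'rV[R]_M | exists2 p, hull P p & forall i, p 0 i <= x 0 i].

Definition Qset (R : realType) (M : nat) (lambda : R) : set 'rV[R]_M :=
  [set 0] `|` range (fun i : 'I_M => lambda *: delta_mx 0 i).

Arguments Qset {R} M lambda.

(* Main.v *)
(* A point F(x) lies in ExtHull(P) only if each coordinate i has a witness
   p^i in P with p^i_i <= F_i(x).  Either some p^i equals F(x), or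
   p^i_i <= (M+1) F_i(x) for all i because the values of F_i form a geometric
   progression of ratio M+1.  As F < 0, then d := (M+1) F(x) - sum_i p^i is
   nonnegative, with coordinate sum at most lambda := M^2 (M+1)^N, and
   F(x) = M/(M+1) (mean of the p^i) + 1/(M+1) d with d in Hull(Q_lambda).
   Conversely, the points that are nonnegative or dominate some point of
   Hull(P) form a convex set, since Hull(P) lies in the negative orthant. *)
Require Import Defs.
From mathcomp Require Import all_boot all_order all_algebra.
From mathcomp Require Import all_classical all_reals.
From mathcomp Require Import interval_inference convex ring lra.

Set Implicit Arguments.
Unset Strict Implicit.
Unset Printing Implicit Defensive.

Import Order.TTheory GRing.Theory Num.Theory.

Local Open Scope classical_set_scope.
Local Open Scope ring_scope.

(** Trades the bundled weights [Itv01] for a real [t] with two bounds, the form that [lra] and [nra]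
    can use. *)
Lemma convex_setP (R : realType) (V : lmodType R) (A : set V) :
  @convex_set R V A <->
  forall (x y : V) (t : R), 0 <= t -> t <= 1 -> A x -> A y ->
    A (t *: x + (1 - t) *: y).
Proof.
split=> [cA x y t t0 t1 Ax Ay|cA x y t /set_mem Ax /set_mem Ay]; last first.
  by apply/mem_set; apply: cA.
have /set_mem := cA x y (Itv01 t0 t1) (mem_set Ax) (mem_set Ay).
exact.
Qed.

(** Keeping the total weight as a factor avoids normalising and lets the induction absorb one point
    at a time. *)
Lemma convex_set_sum (R : realType) (V : lmodType R) (A : set V) (I : Type)
    (s : seq I) (w : I -> R) (f : I -> V) :
  @convex_set R V A -> A !=set0 -> (forall i, 0 <= w i) ->
  (forall i, A (f i)) ->
  exists2 a, A a & \sum_(i <- s) w i *: f i = (\sum_(i <- s) w i) *: a.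
Proof.
move=> /convex_setP cA [a0 Aa0] w0 Af; elim: s => [|i s [a Aa IH]].
  by exists a0 => //; rewrite !big_nil scale0r.
rewrite !big_cons IH; set W := \sum_(j <- s) w j.
have W0 : 0 <= W by rewrite sumr_ge0.
(* With zero total weight there is nothing to divide by, but any point of [A] then serves. *)
have [wW0|wW0] := eqVneq (w i + W) 0.
  have [-> ->] : w i = 0 /\ W = 0 by have := w0 i; split; lra.
  by exists a; rewrite ?addr0 ?scale0r ?addr0.
have wW_gt0 : 0 < w i + W by rewrite lt_neqAle eq_sym wW0 addr_ge0.
exists ((w i / (w i + W)) *: f i + (1 - w i / (w i + W)) *: a).
  apply: cA => //; first by rewrite divr_ge0// ltW.
  by rewrite ler_pdivrMr// mul1r lerDl.
rewrite scalerDr !scalerA; congr (_ *: _ + _ *: _); field; exact: wW0.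
Qed.

Lemma hull_sub (R : realType) (M : nat) (P : set 'rV[R]_M) : P `<=` hull P.
Proof. exact: sub_gen_smallest. Qed.

Lemma hull_min (R : realType) (M : nat) (P C : set 'rV[R]_M) :
  (forall x y t, 0 <= t -> t <= 1 -> C x -> C y -> C (t *: x + (1 - t) *: y)) ->
  P `<=` C -> hull P `<=` C.
Proof. by move=> /convex_setP; exact: smallest_sub. Qed.

Lemma hull_convex (R : realType) (M : nat) (P : set 'rV[R]_M) (x y : 'rV[R]_M)
    (t : R) :
  0 <= t -> t <= 1 -> hull P x -> hull P y -> hull P (t *: x + (1 - t) *: y).
Proof.
move=> t0 t1 Hx Hy C [cC PC].
by move/convex_setP: (cC); apply=> //; [apply: Hx|apply: Hy].
Qed.

(** Otherwise [P], and with it its hull, would lie in the open half-space of points exceeding [x] in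
    coordinate [i]. *)
Lemma ext_hull_coord (R : realType) (M : nat) (P : set 'rV[R]_M)
    (x : 'rV[R]_M) (i : 'I_M) :
  ext_hull P x -> exists2 p, P p & p 0 i <= x 0 i.
Proof.
move=> [p Pp px]; apply: contrapT => nP.
suff : [set z : 'rV[R]_M | x 0 i < z 0 i] p by move/lt_geF; rewrite px.
apply: (hull_min _ _ Pp) => [y z t t0 t1 /= xy xz|y Py /=].
  (* Strictness comes from [z] when [t = 0] and from [y] when [t > 0]. *)
  rewrite !mxE; have [->|t_neq0] := eqVneq t 0; first by lra.
  have t_gt0 : 0 < t by rewrite lt_neqAle eq_sym t_neq0.
  nra.
by rewrite ltNge; apply/negP => yx; apply: nP; exists y.
Qed.

Section Embedding.
Context {R : realType} {E : finType} {M : nat} (ge : 'I_M -> rel E).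

Lemma position_inj (r : rel E) : injective (position r).
Proof.
by move=> x y [] /(@index_inj _ x); apply; rewrite mem_sort mem_enum.
Qed.

Lemma position_le (r : rel E) (x : E) : (position r x <= #|E|)%N.
Proof. by rewrite /position cardE -(size_sort r) index_mem mem_sort mem_enum. Qed.

Lemma embed_lt0 (x : E) (i : 'I_M) : embed R ge x 0 i < 0.
Proof. by rewrite mxE oppr_lt0 exprn_gt0. Qed.

Lemma embed_ge (x : E) (i : 'I_M) : - (M.+1%:R ^+ #|E|) <= embed R ge x 0 i.
Proof. by rewrite mxE lerN2 ler_weXn2l ?ler1n// position_le. Qed.

(** Positions are integers, so a strictly lower element has an exponent larger by at least one. *)
Lemma embed_gap (x y : E) (i : 'I_M) :
  embed R ge y 0 i <= embed R ge x 0 i ->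
  y = x \/ embed R ge y 0 i <= M.+1%:R * embed R ge x 0 i.
Proof.
rewrite !mxE lerN2 mulrN lerN2 -exprS => xy.
have [/position_inj|ne] := eqVneq (position (ge i) y) (position (ge i) x).
  by left.
right; rewrite ler_weXn2l ?ler1n// ltn_neqAle eq_sym ne.
have M1 : 1 < M.+1%:R :> R by rewrite ltr1n ltnS (leq_trans _ (ltn_ord i)).
by rewrite -(ler_eXn2l M1).
Qed.

Lemma hull_embed_le0 (P : set 'rV[R]_M) (p : 'rV[R]_M) (i : 'I_M) :
  P `<=` range (embed R ge) -> hull P p -> p 0 i <= 0.
Proof.
move=> PE; apply: (hull_min (C := [set z : 'rV_M | z 0 i <= 0])).
  by move=> x y t t0 t1 /= x0 y0; rewrite !mxE; nra.
by move=> _ /PE[x _ <-] /=; rewrite ltW// embed_lt0.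
Qed.

Lemma hullU_Qset_sub (lambda : R) (P : set 'rV[R]_M) (z : 'rV[R]_M) :
  0 < lambda -> P `<=` range (embed R ge) -> hull (P `|` Qset M lambda) z ->
  (forall i, 0 <= z 0 i) \/ ext_hull P z.
Proof.
move=> l0 PE.
apply: (hull_min (C := [set z : 'rV_M |
  (forall i, 0 <= z 0 i) \/ ext_hull P z])) => [x y t t0 t1 /=|].
  have neg p i : hull P p -> p 0 i <= 0 by exact: hull_embed_le0 PE.
  move=> [x0|[p Pp px]] [y0|[q Pq qy]].
  (* In the mixed cases, shrinking a nonpositive hull point by a weight in [0,1] only raises it, so
     it is still dominated. *)
  - by left=> i; rewrite !mxE; have := x0 i; have := y0 i; nra.
  - right; exists q => // i; rewrite !mxE.
    by have := x0 i; have := qy i; have := neg q i Pq; nra.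
  - right; exists p => // i; rewrite !mxE.
    by have := y0 i; have := px i; have := neg p i Pp; nra.
  - right; exists (t *: p + (1 - t) *: q); first exact: hull_convex.
    by move=> i; rewrite !mxE; have := px i; have := qy i; nra.
move=> x [Px|[->|[i _ <-]]] /=.
- by right; exists x => //; exact: hull_sub.
- by left=> i; rewrite mxE.
- by left=> j; rewrite !mxE mulr_ge0 ?ler0n// ltW.
Qed.

End Embedding.

(** The vertex [lambda *: delta_mx 0 i] gets weight [d 0 i / lambda]; the vertex 0 takes the
    rest. *)
Lemma hull_Qset (R : realType) (M : nat) (lambda : R) (P : set 'rV[R]_M)
    (d : 'rV[R]_M) :
  0 < lambda -> (forall i, 0 <= d 0 i) -> \sum_i d 0 i <= lambda ->
  hull (P `|` Qset M lambda) d.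
Proof.
move=> l0 d0 dl; set H := hull _.
have H0 : H 0 by apply: hull_sub; right; left.
have cH : @convex_set R 'rV[R]_M H by apply/convex_setP; exact: hull_convex.
have He i : H (lambda *: delta_mx 0 i) by apply: hull_sub; right; right; exists i.
have w0 i : 0 <= d 0 i / lambda by rewrite divr_ge0// ltW.
have [|b Hb sb] := convex_set_sum (index_enum 'I_M) cH _ w0 He.
  by exists 0.
have -> : d = (\sum_i d 0 i / lambda) *: b.
  rewrite -sb [LHS]row_sum_delta; apply: eq_bigr => i _.
  by rewrite scalerA divfK// gt_eqF.
rewrite -[_ *: b]addr0 -(scaler0 _ (1 - \sum_i d 0 i / lambda)).
apply: hull_convex => //; first exact: sumr_ge0.
by rewrite -mulr_suml ler_pdivrMr// mul1r.
Qed.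

Theorem theorem4 (R : realType) (E : finType) (M : nat) (hM : (0 < M)%N)
    (ge : 'I_M -> rel E) (hge : forall i, linear_order (ge i)) :
  exists2 lambda : R, 0 < lambda &
    forall P : set 'rV[R]_M, P `<=` range (embed R ge) ->
      hull (P `|` Qset M lambda) `&` range (embed R ge)
      = ext_hull P `&` range (embed R ge).
Proof.
(* [K] bounds the absolute value of every coordinate of F; [lambda] allows for M witnesses in each
   of M coordinates. *)
set K : R := M.+1%:R ^+ #|E|; set lambda : R := M%:R * (M%:R * K).
have l0 : 0 < lambda by rewrite !mulr_gt0 ?ltr0n// exprn_gt0.
exists lambda => // P PE; apply/seteqP; split=> _ [] /[swap] -[x _ <-] Hx.
  split; last by exists x.
  have [x0|//] := hullU_Qset_sub l0 PE Hx.
  by have := x0 (Ordinal hM); rewrite leNgt embed_lt0.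
split; last by exists x.
(* Once F(x) is outside [P], no witness equals it and the gap applies in every coordinate. *)
have [Px|nPx] := pselect (P (embed R ge x)); first by apply: hull_sub; left.
have wit i : exists y, P (embed R ge y) /\
    embed R ge y 0 i <= M.+1%:R * embed R ge x 0 i.
  have [_ /[dup] /PE[y _ <-] Py yx] := ext_hull_coord i Hx.
  exists y; split=> //.
  by have [yx0|//] := embed_gap yx; rewrite yx0 in Py.
have [y /all_and2[Py yx]] := choice wit.
set H := hull _.
have cH : @convex_set R 'rV[R]_M H by apply/convex_setP; exact: hull_convex.
have Hy i : H (embed R ge (y i)) by apply: hull_sub; left.
have H0 : H !=set0 by exists (embed R ge (y (Ordinal hM))).
(* Unit weights make [a] the mean of the M witnesses. *)
have [a Ha] := convex_set_sum (index_enum 'I_M) cH H0 (fun=> ler01) Hy.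
rewrite sumr_const cardT size_enum_ord => sa.
set d := M.+1%:R *: embed R ge x - \sum_k embed R ge (y k).
have dE i : d 0 i = M.+1%:R * embed R ge x 0 i - \sum_k embed R ge (y k) 0 i.
  by rewrite !mxE summxE.
have Hd : H d.
  apply: hull_Qset => // [i|].
    (* The i-th witness alone is low enough in coordinate [i]; the others only lower the sum. *)
    rewrite dE subr_ge0 (bigD1 i)//= -[leRHS]addr0 lerD//.
    by apply: sumr_le0 => k _; rewrite ltW// embed_lt0.
  have dK i : d 0 i <= M%:R * K.
    rewrite dE -[leRHS]add0r lerD//.
      by rewrite mulr_ge0_le0 ?ler0n// ltW// embed_lt0.
    rewrite -sumrN -[M in M%:R]card_ord mulr_natl -sumr_const ler_sum// => k _.
    by rewrite lerNl embed_ge.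
  rewrite /lambda -[M in M%:R * (_ * _)]card_ord mulr_natl -sumr_const.
  exact: ler_sum.
have M1 : M.+1%:R != 0 :> R by rewrite pnatr_eq0.
have -> : embed R ge x = (M%:R / M.+1%:R) *: a + (1 - M%:R / M.+1%:R) *: d.
  have -> : 1 - M%:R / M.+1%:R = M.+1%:R^-1 :> R.
    by move: M1; rewrite -natr1 => M1; field.
  rewrite mulrC -scalerA -sa (eq_bigr (fun k => embed R ge (y k))).
    by rewrite -scalerDr /d addrC subrK scalerA mulVf// scale1r.
  by move=> k _; rewrite scale1r.
apply: hull_convex => //.
by rewrite ler_pdivrMr ?ltr0n// mul1r ler_nat.
Qed.
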